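(* Let $\mathcal{A}=\{H_1,\dots,H_m\}$ be any central hyperplane arrangement in $\mathbb{R}^n$ with set of faces $\mathcal{F}$ and set of chambers $\mathcal{C}$, and let $w$ be a separating probability measure on $\mathcal{F}$. Then for every integer $t\ge0$, $$\mathbb{P}(T>t)\le s(t),$$ where $s(t)$ is the separation distance at time $t$ of the walk on $\mathcal{C}$ driven by $w$, and $T$ is the first time that the product of the faces picked is a chamber.
   Context: A central hyperplane arrangement $\mathcal{A}=\{H_1,\dots,H_m\}$ is a finite collection of hyperplanes of $\mathbb{R}^n$ passing through the origin. For each $i$, let $H_i^+,H_i^-$ be the two open half-spaces determined by $H_i$ and $H_i^0=H_i$. A face is a nonempty set of the form $F=\bigcap_{i=1}^m H_i^{\sigma_i(F)}$ with $\sigma_i(F)\in\{+,-,0\}$. A chamber is a face with $\sigma_i(F)\neq 0$ for all $i$. $\mathcal{F}$ is the set of faces and $\mathcal{C}\subseteq\mathcal{F}$ the set of chambers. The product $FG$ of faces is the face with $\sigma_i(FG)=\sigma_i(F)$ if $\sigma_i(F)\ne 0$ and $\sigma_i(FG)=\sigma_i(G)$ otherwise; it is associative, and $FC\in\mathcal{C}$ for $C\in\mathcal{C}$. A probability measure $w$ on $\mathcal{F}$ is separating if for every $H\in\mathcal{A}$ there is a face $F\nsubseteq H$ with $w(F)>0$. The walk: let $F^1,F^2,\dots$ be i.i.d. faces with law $w$; started at $x_0\in\mathcal{C}$, the walk at time $t$ is $C^t_{x_0}=F^tF^{t-1}\cdots F^1x_0$. As $w$ is separating, this Markov chain has a unique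 stationary distribution $\pi$ on $\mathcal{C}$. $T$ is the first time $t$ such that $F^t\cdots F^1$ is a chamber (the empty product being the face with all signs $0$). Separation distance: $s(t)=\max_{x_0\in\mathcal{C}}\left(1-\min_{x\in\mathcal{C}:\,\pi(x)>0}\frac{\mathbb{P}(C^t_{x_0}=x)}{\pi(x)}\right)$. *)

(* Defs.v *)
From HB Require Import structures.
From mathcomp Require Import all_boot all_order all_algebra.
From mathcomp Require Import all_classical all_reals all_analysis.

Set Implicit Arguments.
Unset Strict Implicit.
Unset Printing Implicit Defensive.

Import Order.TTheory GRing.Theory Num.Theory.

Local Open Scope classical_set_scope.
Local Open Scope ring_scope.

Inductive sign := Pos | Neg | Zero.

Definition sign_encode (s : sign) : option bool :=
  match s with Pos => Some true | Neg => Some false | Zero => None end.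

Definition sign_decode (b : option bool) : sign :=
  match b with Some true => Pos | Some false => Neg | None => Zero end.

Lemma sign_encodeK : cancel sign_encode sign_decode.
Proof. by case. Qed.

HB.instance Definition _ := Finite.copy sign (can_type sign_encodeK).

Section Geometry.
Context {R : realType} {n : nat}.

Definition dot (a x : 'rV[R]_n) : R := \sum_(j < n) a 0 j * x 0 j.

Definition hyperplane (a : 'rV[R]_n) : set 'rV[R]_n := [set x | dot a x = 0].

Definition half_space (a : 'rV[R]_n) (s : sign) : set 'rV[R]_n :=
  match s with
  | Pos => [set x | 0 < dot a x]
  | Neg => [set x | dot a x < 0]
  | Zero => hyperplane a
  end.

End Geometry.

(* The hyperplane H_i is the orthogonal of [normal i]; the direction of the
   normal vector fixes which side of H_i is called H_i^+. *)
Record arrangement (R : realType) (n m : nat) := Arrangement {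
  normal : 'I_m -> 'rV[R]_n;
  normal_neq0 : forall i, normal i != 0;
  hyperplane_inj : injective (fun i => hyperplane (normal i))
}.

Section Faces.
Context {R : realType} {n m : nat}.
Variable A : arrangement R n m.

Definition cell (sigma : {ffun 'I_m -> sign}) : set 'rV[R]_n :=
  \bigcap_(i in [set: 'I_m]) half_space (normal A i) (sigma i).

(* A nonempty cell determines its sign vector, so a face is encoded by its sign
   vector; the face as a set is recovered by [face_set]. *)
Definition face := {sigma : {ffun 'I_m -> sign} | `[< cell sigma !=set0 >]}.

HB.instance Definition _ := Finite.on face.

Definition face_sign (F : face) : {ffun 'I_m -> sign} := val F.

Definition face_set (F : face) : set 'rV[R]_n := cell (face_sign F).

Definition is_chamber (F : face) : bool := [forall i, face_sign F i != Zero].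

Definition chamber := {F : face | is_chamber F}.

HB.instance Definition _ := Finite.on chamber.

Definition sign_mul (s t : {ffun 'I_m -> sign}) : {ffun 'I_m -> sign} :=
  [ffun i => if s i == Zero then t i else s i].

Lemma dotDZ (a x y : 'rV[R]_n) (c : R) :
  dot a (c *: x + y) = c * dot a x + dot a y.
Proof.
rewrite /dot mulr_sumr -big_split /=; apply: eq_bigr => j _.
by rewrite !mxE mulrDr mulrCA.
Qed.

Lemma cell0 : cell [ffun=> Zero] !=set0.
Proof.
exists 0 => i _; rewrite ffunE /= /hyperplane /= /dot.
by apply: big1 => j _; rewrite mxE mulr0.
Qed.

Lemma cell_mul (s t : {ffun 'I_m -> sign}) :
  cell s !=set0 -> cell t !=set0 -> cell (sign_mul s t) !=set0.
Proof.
move=> [x xs] [y yt].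
pose q i := `|dot (normal A i) y| / `|dot (normal A i) x|.
pose c := 1 + \sum_i q i.
have q0 i : 0 <= q i by rewrite /q divr_ge0.
have cq i : q i < c.
  rewrite /c (bigD1 i) //= addrCA ltrDl ltr_pwDl //.
  exact: sumr_ge0.
exists (c *: x + y) => i _; rewrite ffunE.
have bnd : dot (normal A i) x != 0 ->
    `|dot (normal A i) y| < c * `|dot (normal A i) x|.
  by move=> d0; rewrite -ltr_pdivrMr ?normr_gt0 //; exact: cq.
have := xs i Logic.I; have := yt i Logic.I.
case: (s i) => /= [_|_|ty] sx; rewrite ?eqxx.
- rewrite dotDZ; have := bnd (lt0r_neq0 sx).
  by rewrite (gtr0_norm sx) ltr_norml -subr_gt0 opprK addrC => /andP[].
- rewrite dotDZ; have := bnd (ltr0_neq0 sx).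
  by rewrite (ltr0_norm sx) mulrN ltr_norml -[X in _ && X]subr_gt0 -opprD
    oppr_gt0 => /andP[].
- have e z : z = dot (normal A i) y -> z = dot (normal A i) (c *: x + y).
    by move=> ->; rewrite dotDZ sx mulr0 add0r.
  by case: (t i) ty => /=; rewrite /hyperplane /= -(e _ erefl).
Qed.

Definition face0 : face := exist _ [ffun=> Zero] (asboolT cell0).

Definition face_mul (F G : face) : face :=
  exist _ (sign_mul (face_sign F) (face_sign G))
    (asboolT (cell_mul (asboolW (valP F)) (asboolW (valP G)))).

Lemma chamber_mul (F : face) (C : chamber) : is_chamber (face_mul F (val C)).
Proof.
apply/forallP => i; rewrite /face_sign /= ffunE.
by case: ifPn => // _; exact: (forallP (valP C)).
Qed.

Definition chamber_act (F : face) (C : chamber) : chamber :=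
  exist _ (face_mul F (val C)) (chamber_mul F C).

Definition separating (w : face -> R) : Prop :=
  forall i, exists F : face,
    ~ (face_set F `<=` hyperplane (normal A i)) /\ 0 < w F.

Definition transition (w : face -> R) (x y : chamber) : R :=
  \sum_(F : face | chamber_act F x == y) w F.

End Faces.

Definition is_distribution (R : realType) (S : finType) (p : S -> R) : Prop :=
  (forall x, 0 <= p x) /\ \sum_x p x = 1.

Definition stationary (R : realType) (n m : nat) (A : arrangement R n m)
    (w : face A -> R) (pi : chamber A -> R) : Prop :=
  is_distribution pi /\
  forall y, pi y = \sum_x pi x * transition w x y.

Section Walk.
Context {R : realType} {d : measure_display} {Omega : measurableType d}.
Variable P : probability Omega R.

Definition mutually_independent (S : Type) (X : nat -> Omega -> S) : Prop :=
  forall (J : seq nat) (B : nat -> set S), uniq J ->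
    P (\bigcap_(j in [set` J]) X j @^-1` B j) =
    (\prod_(j <- J) P (X j @^-1` B j))%E.

Definition iid (S : finType) (w : S -> R) (X : nat -> Omega -> S) : Prop :=
  [/\ forall k (B : set S), measurable (X k @^-1` B),
      forall k x, P (X k @^-1` [set x]) = (w x)%:E
    & mutually_independent X].

Context {n m : nat} {A : arrangement R n m}.
(* [X k] is the face F^(k+1) picked at step k+1. *)
Variable X : nat -> Omega -> face A.

Fixpoint face_product (t : nat) (omega : Omega) : face A :=
  if t is t'.+1 then face_mul (X t' omega) (face_product t' omega)
  else face0 A.

Fixpoint walk (x0 : chamber A) (t : nat) (omega : Omega) : chamber A :=
  if t is t'.+1 then chamber_act (X t' omega) (walk x0 t' omega) else x0.

(* Equal to +oo when no partial product is a chamber. *)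
Definition chamber_time (omega : Omega) : \bar R :=
  ereal_inf [set k%:R%:E | k in [set k | is_chamber (face_product k omega)]].

(* The sup and the inf range over finite sets, nonempty as soon as [pi] is a
   probability distribution, hence are a max and a min. *)
Definition separation_distance (pi : chamber A -> R) (t : nat) : R :=
  sup [set 1 - inf [set fine (P [set omega | walk x0 t omega = x]) / pi x
                     | x in [set x | 0 < pi x]]
        | x0 in [set: chamber A]].

End Walk.

(* Main.v *)
(**
  Let [-x0] be the chamber opposite to [x0]; it exists because the arrangement
  is central.  The walk started at [x0] is the face product [F^t ... F^1]
  multiplied by [x0], and it can be at [-x0] only if every sign of [x0] has
  been overwritten, that is, only if the face product is itself the chamber
  [-x0].  Hence [P(C^t_{x0} = -x0) = P(F^t ... F^1 = -x0)], and these
  probabilities add up to [P(T <= t)] over all chambers.  As [pi] has total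
  mass 1, some chamber [x] with [pi x > 0] satisfies
  [P(F^t ... F^1 = x) <= pi x * P(T <= t)], and starting the walk at [-x]
  gives [s(t) >= 1 - P(T <= t)].
*)
Require Import Defs.
From HB Require Import structures.
From mathcomp Require Import all_boot all_order all_algebra.
From mathcomp Require Import all_classical all_reals all_analysis.

Set Implicit Arguments.
Unset Strict Implicit.
Unset Printing Implicit Defensive.

Import Order.TTheory GRing.Theory Num.Theory.

Local Open Scope classical_set_scope.
Local Open Scope ring_scope.

Lemma distribution_pos (R : realType) (S : finType) (p : S -> R) :
  is_distribution p -> exists x, 0 < p x.
Proof.
move=> [p_ge0 p_sum]; apply: contrapT => no_pos.
have : \sum_x p x = 0.
  apply: big1 => x _; apply/eqP; rewrite eq_le p_ge0 andbT leNgt.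
  by apply/negP => px; apply: no_pos; exists x.
by rewrite p_sum => /eqP; rewrite oner_eq0.
Qed.

(** Otherwise [q x] exceeds [p x * \sum_y q y] throughout the support of [p]; off the support [p]
    vanishes, so every difference is nonnegative. The differences sum to zero, hence all vanish,
    contrary to strictness. *)
Lemma distribution_averaging (R : realType) (S : finType) (p q : S -> R) :
  is_distribution p -> (forall x, 0 <= q x) ->
  exists2 x, 0 < p x & q x <= p x * \sum_y q y.
Proof.
move=> p_distr q_ge0; have [x px] := distribution_pos p_distr.
apply: contrapT => none; have [p_ge0 p_sum] := p_distr.
set Q := \sum_y q y in none.
have q_gt y : 0 < p y -> p y * Q < q y.
  by move=> py; rewrite ltNge; apply/negP => qy; apply: none; exists y.
have diff_ge0 y : true -> 0 <= q y - p y * Q.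
  move=> _; rewrite subr_ge0; have := p_ge0 y; rewrite le_eqVlt.
  by case/predU1P => [<-|/q_gt/ltW//]; rewrite mul0r.
have /(psumr_eq0P diff_ge0)/(_ x isT)/eqP : \sum_y (q y - p y * Q) = 0.
  by rewrite sumrB -mulr_suml p_sum mul1r subrr.
by rewrite subr_eq0 => /eqP qx; have := q_gt x px; rewrite qx ltxx.
Qed.

Section OppositeChamber.
Context {R : realType} {n m : nat} {A : arrangement R n m}.

Definition sign_opp (s : sign) : sign :=
  match s with Pos => Neg | Neg => Pos | Zero => Zero end.

Lemma sign_oppK : involutive sign_opp.
Proof. by case. Qed.

Lemma sign_opp_eq0 s : (sign_opp s == Zero) = (s == Zero).
Proof. by case: s. Qed.

Lemma sign_opp_neq s : s != Zero -> sign_opp s != s.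
Proof. by case: s. Qed.

Lemma dotN (a x : 'rV[R]_n) : dot a (- x) = - dot a x.
Proof.
by rewrite /dot -sumrN; apply: eq_bigr => j _; rewrite mxE mulrN.
Qed.

(** All hyperplanes pass through the origin, so negating a point of the cell flips each of its
    signs. *)
Lemma cell_opp (s : {ffun 'I_m -> sign}) :
  cell A s !=set0 -> cell A [ffun i => sign_opp (s i)] !=set0.
Proof.
move=> [x xs]; exists (- x) => i _; rewrite ffunE.
have := xs i Logic.I; case: (s i) => /=; rewrite /hyperplane /= dotN.
- by rewrite oppr_lt0.
- by rewrite oppr_gt0.
- by move=> ->; rewrite oppr0.
Qed.

Definition face_opp (F : face A) : face A :=
  exist _ [ffun i => sign_opp (face_sign F i)]
    (asboolT (cell_opp (asboolW (valP F)))).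

Lemma is_chamber_opp (C : chamber A) : is_chamber (face_opp (val C)).
Proof.
apply/forallP => i; rewrite /face_sign /= ffunE sign_opp_eq0.
exact: (forallP (valP C)).
Qed.

Definition chamber_opp (C : chamber A) : chamber A :=
  exist _ (face_opp (val C)) (is_chamber_opp C).

Lemma chamber_oppK : involutive chamber_opp.
Proof.
move=> C; do 2!apply: val_inj => /=; apply/ffunP => i.
by rewrite !ffunE sign_oppK.
Qed.

Lemma face_mulA : associative (@face_mul R n m A).
Proof.
move=> F G H; apply: val_inj; apply/ffunP => i /=; rewrite !ffunE.
by case: (face_sign F i) => //=; rewrite ?eqxx.
Qed.

Lemma face_mul0 : left_id (face0 A) (@face_mul R n m A).
Proof. by move=> F; apply: val_inj; apply/ffunP => i /=; rewrite !ffunE. Qed.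

Lemma is_chamber_mul (F G : face A) :
  is_chamber G -> is_chamber (face_mul F G).
Proof. by move=> chG; exact: (chamber_mul F (exist _ G chG)). Qed.

Lemma face_mul_chamberl (C : chamber A) (F : face A) :
  face_mul (val C) F = val C.
Proof.
apply: val_inj; apply/ffunP => i /=; rewrite ffunE.
by rewrite (negbTE (forallP (valP C) i)).
Qed.

(** Where [F] has sign [Zero] the product keeps the sign of [C], which is nonzero and so differs
    from its opposite; hence [F] alone must supply every sign. *)
Lemma face_mul_opp (F : face A) (C : chamber A) :
  face_mul F (val C) = val (chamber_opp C) <-> F = val (chamber_opp C).
Proof.
split=> [eqFC|->]; last exact: face_mul_chamberl.
apply: val_inj; apply/ffunP => i.
have := congr1 (fun G => face_sign G i) eqFC.
rewrite /face_sign /= !ffunE; case: ifP => // _ /esym eqC.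
by have := sign_opp_neq (forallP (valP C) i); rewrite [sign_opp _]eqC eqxx.
Qed.

End OppositeChamber.

Section Walk.
Context {R : realType} {d : measure_display} {Omega : measurableType d}.
Context {n m : nat} {A : arrangement R n m}.
Variable X : nat -> Omega -> face A.

Lemma val_walk (x0 : chamber A) (t : nat) (omega : Omega) :
  val (walk X x0 t omega) = face_mul (face_product X t omega) (val x0).
Proof.
elim: t => [|t IHt] /=; first by rewrite face_mul0.
by rewrite IHt face_mulA.
Qed.

Lemma walk_oppE (x : chamber A) (t : nat) :
  [set omega | walk X (chamber_opp x) t omega = x] =
  face_product X t @^-1` [set val x].
Proof.
apply/seteqP; split => omega /=.
  move/(congr1 val); rewrite val_walk -[in RHS](chamber_oppK x).
  by move/face_mul_opp; rewrite chamber_oppK.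
move=> prod_eq; apply: val_inj; rewrite val_walk -[in RHS](chamber_oppK x).
by apply/face_mul_opp; rewrite chamber_oppK.
Qed.

Lemma is_chamber_product_le (k t : nat) (omega : Omega) : (k <= t)%N ->
  is_chamber (face_product X k omega) -> is_chamber (face_product X t omega).
Proof.
elim: t => [|t IHt]; first by rewrite leqn0 => /eqP ->.
rewrite leq_eqVlt ltnS => /predU1P[-> //|/IHt h] /h.
exact: is_chamber_mul.
Qed.

(** A chamber stays a chamber under later left factors, so testing the product at time [t] alone
    decides whether a chamber was reached by then. *)
Lemma chamber_time_gtE (t : nat) :
  [set omega | (t%:R%:E < chamber_time X omega)%E] =
  ~` (face_product X t @^-1` [set F | is_chamber F]).
Proof.
apply/seteqP; split => omega /=.
  move=> lt_t ch; move: lt_t; rewrite ltNge => /negP; apply.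
  by apply: ereal_inf_lbound; exists t.
(* Every index in the infimum is at least [t.+1]; this bound keeps the inequality strict, also when
   there is no index and the infimum is infinite. *)
move=> nch; apply: (@lt_le_trans _ _ t.+1%:R%:E).
  by rewrite lte_fin ltr_nat.
apply: le_ereal_inf_tmp => _ [k /= chk <-]; rewrite lee_fin ler_nat ltnNge.
by apply/negP => kt; apply: nch; exact: is_chamber_product_le kt chk.
Qed.

Lemma measurable_face_product :
  (forall k (B : set (face A)), measurable (X k @^-1` B)) ->
  forall t (B : set (face A)), measurable (face_product X t @^-1` B).
Proof.
move=> mX; elim=> [|t IHt] B.
  rewrite (_ : _ @^-1` _ = if `[< B (face0 A) >] then setT else set0).
    by case: ifP.
  apply/seteqP; case: ifPn => [/asboolP|/asboolPn] h; split => //.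
(* Splitting over the finitely many values [G] of the earlier product leaves events on [X t] and on
   that product. *)
rewrite (_ : _ @^-1` _ = \bigcup_(G in [set: face A])
    (X t @^-1` [set F | B (face_mul F G)] `&` face_product X t @^-1` [set G])).
  by apply: fin_bigcup_measurable => // G _; apply: measurableI.
apply/seteqP; split => omega /=; first by exists (face_product X t omega).
by case=> G _ /= [] /[swap] <-.
Qed.

Variable P : probability Omega R.
Hypothesis mX : forall k (B : set (face A)), measurable (X k @^-1` B).

Lemma sum_chamber_product (t : nat) :
  \sum_(x : chamber A) fine (P (face_product X t @^-1` [set val x])) =
  fine (P (face_product X t @^-1` [set F | is_chamber F])).
Proof.
have mprod := measurable_face_product mX t.
rewrite (_ : [set F | is_chamber F] =
    \bigcup_(x in [set: chamber A]) [set val x]); last first.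
  apply/seteqP; split => [F /= chF|_ [x _ ->]]; last exact: valP.
  by exists (exist _ F chF).
rewrite preimage_bigcup measure_fin_bigcup //; last first.
- by move=> x y _ _ [omega [/= -> /val_inj]].
- exact: finite_finset.
rewrite sum_fine; last by move=> x _; exact: fin_num_measure.
congr fine; rewrite -set_true; apply: bigfs; first exact: index_enum_uniq.
by move=> x _; rewrite mem_index_enum.
Qed.

Lemma separation_distance_ge (pi : chamber A -> R) (t : nat)
    (x0 x : chamber A) : 0 < pi x ->
  1 - fine (P [set omega | walk X x0 t omega = x]) / pi x
  <= separation_distance P X pi t.
Proof.
move=> pix.
(* Nonnegative ratios bound the inner sets below by 0, hence the outer set above by 1; without such
   bounds [inf] and [sup] would take a default value. *)
have ratio_ge0 y0 : lbound [set fine (P [set omega | walk X y0 t omega = y])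
    / pi y | y in [set y | 0 < pi y]] 0.
  by move=> _ [y /= piy <-]; rewrite divr_ge0 ?fine_ge0 // ltW.
apply: (@le_trans _ _ (1 - inf [set
    fine (P [set omega | walk X x0 t omega = y]) / pi y | y in [set y | 0 < pi y]])).
  by rewrite lerD2l lerN2; apply: ge_inf; [exists 0 | exists x].
apply: ub_le_sup; last by exists x0.
exists 1 => _ [y0 _ <-]; rewrite gerBl; apply: lb_le_inf => //.
(* Since [pi x] is positive, [x] makes the set of ratios nonempty for every start [y0]. *)
by eexists; exists x.
Qed.

End Walk.

Theorem theorem4 (R : realType) (n m : nat) (A : arrangement R n m)
    (w : face A -> R) (w_distr : is_distribution w) (w_sep : separating w)
    (pi : chamber A -> R) (pi_stat : stationary w pi)
    (d : measure_display) (Omega : measurableType d) (P : probability Omega R)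
    (X : nat -> Omega -> face A) (X_iid : iid P w X) (t : nat) :
  (P [set omega | t%:R%:E < chamber_time X omega]
   <= (separation_distance P X pi t)%:E)%E.
Proof.
have [mX _ _] := X_iid; have [pi_distr _] := pi_stat.
have mprod := measurable_face_product mX t.
(* Here [q] is the law of the product at time [t] restricted to chambers; its total mass is the
   probability that this product is a chamber. *)
have [x pix] := distribution_averaging pi_distr
  (fun x => fine_ge0 (measure_ge0 P (face_product X t @^-1` [set val x]))).
rewrite sum_chamber_product // => prod_le.
rewrite chamber_time_gtE probability_setC //.
rewrite -(fineK (fin_num_measure P _ (mprod [set F | is_chamber F]))).
rewrite -EFinB lee_fin.
apply: le_trans (separation_distance_ge X P t (chamber_opp x) pix).
by rewrite walk_oppE lerD2l lerN2 ler_pdivrMr // mulrC.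
Qed.
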